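(* For a Hausdorff convergence $\xi$ the following are equivalent: (1) $\xi$ is strongly symmetrizable; (2) $\xi\times\tau$ is strongly symmetrizable for every semi-metrizable pretopology $\tau$; (3) $\xi\times\tau$ is symmetrizable for every prime metrizable topology $\tau$.
   Context: A convergence $\xi$ on a set $X$ is a relation between filters and points, $x\in\lim_\xi\mathcal{F}$, isotone in $\mathcal{F}$ with $x\in\lim_\xi\{x\}^\uparrow$; $\xi\ge\theta$ means $\lim_\xi\mathcal{F}\subset\lim_\theta\mathcal{F}$ for all $\mathcal{F}$. Hausdorff: each filter has at most one limit. $\mathrm{T}\xi$: topology of $\xi$-open sets ($O$ with $\lim_\xi\mathcal{F}\cap O\ne\emptyset\Rightarrow O\in\mathcal{F}$). $\mathrm{I}_1\xi$: $x\in\lim_{\mathrm{I}_1\xi}\mathcal{F}$ iff some countably based $\mathcal{H}\le\mathcal{F}$ has $x\in\lim_\xi\mathcal{H}$. Product $\xi\times\tau$: a filter converges to $(x,y)$ iff its projections converge to $x$ and $y$. A point is isolated if only its principal ultrafilter converges to it; a prime topology has at most one non-isolated point. $\mathrm{Epi}_{\mathrm{I}_1}\xi$ is the coarsest convergence $\theta$ on $|\xi|$ with $\mathrm{T}(\xi\times\tau)=\mathrm{T}(\theta\times\tau)$ for every convergence $\tau=\mathrm{I}_1\tau$; equivalently $\theta\ge\mathrm{Epi}_{\mathrm{I}_1}\xi$ iff $\theta\times\tau\ge\mathrm{T}(\xi\times\tau)$ for every prime metrizable topology $\tau$. A semi-metric on $X$ is $d:X\times X\to[0,\infty)$ symmetric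 with $d(x,y)=0\iff x=y$; $\tilde d$ is the pretopology in which $\mathcal{F}$ converges to $x$ iff $\mathcal{F}$ contains every ball $B(x,\epsilon)=\{y:d(x,y)<\epsilon\}$. $\xi$ is semi-metrizable if $\xi=\tilde d$ for some semi-metric $d$; symmetrizable if $\tilde d\ge\xi\ge\mathrm{T}\tilde d$ for some semi-metric $d$; strongly symmetrizable if $\tilde d\ge\xi\ge\mathrm{Epi}_{\mathrm{I}_1}\tilde d$ for some semi-metric $d$. *)

(* Defs.v *)
From Stdlib Require Import Reals.
Open Scope R_scope.
Set Implicit Arguments.

Definition setfam (X : Type) := (X -> Prop) -> Prop.

Definition is_filter {X : Type} (F : setfam X) : Prop :=
  (forall A B : X -> Prop, F A -> (forall x, A x -> B x) -> F B) /\
  (forall A B : X -> Prop, F A -> F B -> F (fun x => A x /\ B x)) /\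
  F (fun _ => True) /\
  ~ F (fun _ => False).

Definition principal {X : Type} (x : X) : setfam X := fun A => A x.

Definition fmap {X Y : Type} (f : X -> Y) (F : setfam X) : setfam Y :=
  fun B => F (fun x => B (f x)).

(* A convergence is given by its limit relation  lim F x  ("x in lim F"),
   only meaningful on filters. *)
Definition limrel (X : Type) := setfam X -> X -> Prop.

Definition is_convergence {X : Type} (xi : limrel X) : Prop :=
  (forall (F G : setfam X) (x : X), is_filter F -> is_filter G ->
     (forall A, F A -> G A) -> xi F x -> xi G x) /\
  (forall x : X, xi (principal x) x).

Definition conv_ge {X : Type} (xi theta : limrel X) : Prop :=
  forall (F : setfam X) (x : X), is_filter F -> xi F x -> theta F x.

Definition conv_eq {X : Type} (xi theta : limrel X) : Prop :=
  conv_ge xi theta /\ conv_ge theta xi.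

Definition hausdorff {X : Type} (xi : limrel X) : Prop :=
  forall (F : setfam X) (x y : X), is_filter F -> xi F x -> xi F y -> x = y.

Definition conv_open {X : Type} (xi : limrel X) (O : X -> Prop) : Prop :=
  forall (F : setfam X) (x : X), is_filter F -> xi F x -> O x -> F O.

Definition Tmod {X : Type} (xi : limrel X) : limrel X :=
  fun F x => forall O, conv_open xi O -> O x -> F O.

Definition prod_conv {X Y : Type} (xi : limrel X) (tau : limrel Y) : limrel (X * Y) :=
  fun F p => xi (fmap fst F) (fst p) /\ tau (fmap snd F) (snd p).

Definition countably_based {X : Type} (H : setfam X) : Prop :=
  is_filter H /\
  exists B : nat -> (X -> Prop),
    forall A, H A <-> exists n, forall x, B n x -> A x.

Definition I1 {X : Type} (xi : limrel X) : limrel X :=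
  fun F x => exists H : setfam X, countably_based H /\
     (forall A, H A -> F A) /\ xi H x.

Definition is_topology {X : Type} (xi : limrel X) : Prop :=
  is_convergence xi /\ conv_eq xi (Tmod xi).

Definition vicinity {X : Type} (xi : limrel X) (x : X) : setfam X :=
  fun A => forall F, is_filter F -> xi F x -> F A.

Definition is_pretopology {X : Type} (xi : limrel X) : Prop :=
  is_convergence xi /\ forall x, xi (vicinity xi x) x.

Definition isolated {X : Type} (xi : limrel X) (x : X) : Prop :=
  forall F, is_filter F -> xi F x -> forall A, F A <-> principal x A.

Definition is_prime_topology {X : Type} (xi : limrel X) : Prop :=
  is_topology xi /\
  forall x y : X, ~ isolated xi x -> ~ isolated xi y -> x = y.

Definition semimetric {X : Type} (d : X -> X -> R) : Prop :=
  (forall x y, 0 <= d x y) /\ (forall x y, d x y = d y x) /\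
  (forall x y, d x y = 0 <-> x = y).

Definition metric {X : Type} (d : X -> X -> R) : Prop :=
  semimetric d /\ forall x y z, d x z <= d x y + d y z.

Definition ball {X : Type} (d : X -> X -> R) (x : X) (eps : R) : X -> Prop :=
  fun y => d x y < eps.

Definition dconv {X : Type} (d : X -> X -> R) : limrel X :=
  fun F x => forall eps, 0 < eps -> F (ball d x eps).

Definition semi_metrizable {X : Type} (xi : limrel X) : Prop :=
  exists d, semimetric d /\ conv_eq xi (dconv d).

Definition metrizable {X : Type} (xi : limrel X) : Prop :=
  exists d, metric d /\ conv_eq xi (dconv d).

(* Epi_{I_1} xi : the coarsest convergence theta on |xi| with
   T(xi x tau) = T(theta x tau) for every convergence tau = I_1 tau.
   Rendered as the union (supremum in the coarse direction) of all such theta;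
   the paper asserts this union is itself in the class, i.e. is the coarsest one. *)
Definition epi_class {X : Type} (xi theta : limrel X) : Prop :=
  is_convergence theta /\
  forall (Y : Type) (tau : limrel Y), is_convergence tau -> conv_eq tau (I1 tau) ->
    conv_eq (Tmod (prod_conv xi tau)) (Tmod (prod_conv theta tau)).

Definition Epi_I1 {X : Type} (xi : limrel X) : limrel X :=
  fun F x => exists theta : limrel X, epi_class xi theta /\ theta F x.

Definition symmetrizable {X : Type} (xi : limrel X) : Prop :=
  exists d, semimetric d /\ conv_ge (dconv d) xi /\ conv_ge xi (Tmod (dconv d)).

Definition strongly_symmetrizable {X : Type} (xi : limrel X) : Prop :=
  exists d, semimetric d /\ conv_ge (dconv d) xi /\ conv_ge xi (Epi_I1 (dconv d)).

(* Main.v *)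
(** (3) => (1) is the substantial implication.  Taking [tau] to be a point gives
    a semi-metric [d] with [dconv d >= xi >= T (dconv d)].  Because [xi] is
    Hausdorff, every countably based filter that converges for [xi] already
    converges for [dconv d].  Hence, if [D] symmetrizes [xi x tau], the countably
    based vicinity filters of [dconv D] converge for [dconv d x tau], so that
    [xi x tau >= T (dconv D) >= T (dconv d x tau)].  Finally, any countably based
    filter on [Y] is the image of the punctured neighbourhood filter of the
    non-isolated point of a prime metrizable space, so these test spaces are
    enough to put [xi] in the class defining [Epi_I1 (dconv d)]. *)

Require Import Defs.
From Stdlib Require Import Reals Lra Lia ClassicalEpsilon IndefiniteDescription.
Set Implicit Arguments.
Unset Strict Implicit.

(** * Filters *)

Lemma filter_mono X (F : setfam X) (A B : X -> Prop) :
  is_filter F -> F A -> (forall x, A x -> B x) -> F B.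
Proof. intros [h _]; apply h. Qed.

Lemma filter_and X (F : setfam X) (A B : X -> Prop) :
  is_filter F -> F A -> F B -> F (fun x => A x /\ B x).
Proof. intros [_ [h _]]; apply h. Qed.

Lemma filter_all X (F : setfam X) (A : X -> Prop) :
  is_filter F -> (forall x, A x) -> F A.
Proof.
  intros HF HA; apply (filter_mono (A := fun _ => True) HF); auto.
  apply HF.
Qed.

Lemma filter_nonempty X (F : setfam X) (A : X -> Prop) :
  is_filter F -> F A -> exists x, A x.
Proof.
  intros HF HA; apply NNPP; intro n.
  apply HF; apply (filter_mono HF HA); eauto.
Qed.

Lemma filter_principal X (x : X) : is_filter (principal x).
Proof. unfold principal; repeat split; intuition. Qed.

Lemma filter_fmap X Y (f : X -> Y) (F : setfam X) :
  is_filter F -> is_filter (fmap f F).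
Proof.
  intro HF; unfold fmap; repeat split.
  - intros A B HA HAB; apply (filter_mono HF HA); auto.
  - intros A B HA HB; apply (filter_and HF HA HB).
  - apply HF.
  - apply HF.
Qed.

(** Stands in for an ultrafilter argument. For [Q] either [S] or its complement, [F] contains the
    complement of [Q], which settles [Q x -> A x] vacuously, or the trace of [F] on [Q] is a proper
    filter finer than [F]. *)
Lemma filter_split X (F : setfam X) (S A : X -> Prop) :
  is_filter F ->
  (forall G, is_filter G -> (forall B, F B -> G B) ->
     G S \/ G (fun x => ~ S x) -> G A) ->
  F A.
Proof.
  intros HF H.
  assert (trace : forall Q : X -> Prop,
    (forall G : setfam X, is_filter G -> (forall B, F B -> G B) -> G Q -> G A) ->
    F (fun x => Q x -> A x)).
  { intros Q HQ.
    destruct (classic (F (fun x => ~ Q x))) as [n | n].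
    - apply (filter_mono HF n); tauto.
    - apply (HQ (fun B => F (fun x => Q x -> B x))).
      + repeat split.
        * intros B C HB HBC; apply (filter_mono HF HB); auto.
        * intros B C HB HC; apply (filter_mono HF (filter_and HF HB HC)); firstorder.
        * apply (filter_all HF); auto.
        * exact n.
      + intros B HB; apply (filter_mono HF HB); auto.
      + apply (filter_all HF); auto. }
  assert (h1 := trace S (fun G HG HFG HS => H G HG HFG (or_introl HS))).
  assert (h2 := trace _ (fun G HG HFG HS => H G HG HFG (or_intror HS))).
  apply (filter_mono HF (filter_and HF h1 h2)).
  intros x [a b]; destruct (classic (S x)); auto.
Qed.

Lemma countably_based_decreasing X (H : setfam X) :
  countably_based H ->
  exists B : nat -> X -> Prop,
    (forall m n, (m <= n)%nat -> forall x, B n x -> B m x) /\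
    (forall A, H A <-> exists n, forall x, B n x -> A x).
Proof.
  intros [HH [B HB]].
  exists (fun n x => forall i, (i <= n)%nat -> B i x); split.
  - intros m n mn x Hx i Hi; apply Hx; lia.
  - intro A; split.
    + intro HA; destruct (proj1 (HB A) HA) as [n Hn].
      exists n; auto.
    + intros [n Hn].
      apply (filter_mono (A := fun x => forall i, (i <= n)%nat -> B i x) HH); auto.
      clear Hn; induction n as [| n IH].
      * apply HB; exists 0%nat; intros x Hx i Hi.
        replace i with 0%nat by lia; auto.
      * assert (h : H (B (S n))) by (apply HB; eauto).
        apply (filter_mono HH (filter_and HH IH h)).
        intros x [h1 h2] i Hi.
        destruct (Nat.eq_dec i (S n)) as [-> | ne]; auto.
        apply h1; lia.
Qed.

Lemma countably_based_fmap X Y (f : X -> Y) (H : setfam X) :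
  countably_based H -> countably_based (fmap f H).
Proof.
  intros [HH [B HB]]; split.
  - apply filter_fmap; auto.
  - exists (fun n y => exists x, B n x /\ f x = y).
    intro A; unfold fmap; rewrite HB; split; intros [n Hn]; exists n.
    + intros y [x [Hx <-]]; auto.
    + intros x Hx; apply Hn; eauto.
Qed.

(** * Convergences and their topological modifications *)

Lemma conv_isotone X (xi : limrel X) (F G : setfam X) (x : X) :
  is_convergence xi -> is_filter F -> is_filter G ->
  (forall A, F A -> G A) -> xi F x -> xi G x.
Proof. intros [h _]; apply h. Qed.

Lemma conv_ge_refl X (xi : limrel X) : conv_ge xi xi.
Proof. intros F x _; auto. Qed.

(** A filter that converges for [theta] also converges for [Tmod theta], so comparing the
    modifications carries open sets across. Membership in [epi_class] is checked below through open
    sets. *)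
Lemma conv_eq_Tmod_iff X (xi theta : limrel X) :
  conv_eq (Tmod xi) (Tmod theta) <->
  forall O, conv_open xi O <-> conv_open theta O.
Proof.
  split.
  - intros [h1 h2] O; split; intros HO F x HF Hx Ox.
    + apply (h2 F x HF); auto.
      intros U HU; apply HU; auto.
    + apply (h1 F x HF); auto.
      intros U HU; apply HU; auto.
  - intro h; split; intros F x HF Hx O HO; apply Hx; apply h; exact HO.
Qed.

Lemma conv_open_ge X (xi theta : limrel X) (O : X -> Prop) :
  conv_ge xi theta -> conv_open theta O -> conv_open xi O.
Proof. intros h HO F x HF Hx; apply HO; auto. Qed.

Lemma conv_ge_Tmod X (xi theta : limrel X) :
  conv_ge xi theta -> conv_ge (Tmod xi) (Tmod theta).
Proof.
  intros h F x _ Hx O HO; apply Hx; apply (conv_open_ge h HO).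
Qed.

Lemma prod_conv_convergence X Y (xi : limrel X) (tau : limrel Y) :
  is_convergence xi -> is_convergence tau -> is_convergence (prod_conv xi tau).
Proof.
  intros Hxi Htau; split.
  - intros F G p HF HG HFG [h1 h2]; split.
    + apply (conv_isotone (F := fmap fst F) Hxi); auto using filter_fmap.
      intros A; apply HFG.
    + apply (conv_isotone (F := fmap snd F) Htau); auto using filter_fmap.
      intros A; apply HFG.
  - intros [x y]; split.
    + apply Hxi.
    + apply Htau.
Qed.

Lemma prod_conv_ge X Y (xi xi' : limrel X) (tau tau' : limrel Y) :
  conv_ge xi xi' -> conv_ge tau tau' ->
  conv_ge (prod_conv xi tau) (prod_conv xi' tau').
Proof. intros h k F p HF [a b]; split; auto using filter_fmap. Qed.

Lemma conv_open_homeo X Y (xi : limrel X) (theta : limrel Y)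
    (f : X -> Y) (O : Y -> Prop) :
  (forall F x, is_filter F -> xi F x -> theta (fmap f F) (f x)) ->
  conv_open theta O -> conv_open xi (fun x => O (f x)).
Proof.
  intros h HO F x HF Hx Ox; apply (HO (fmap f F) (f x)); auto using filter_fmap.
Qed.

(** Makes [prod_conv tau sigma] an admissible test convergence in [epi_class_prod]. *)
Lemma I1_prod X Y (xi : limrel X) (tau : limrel Y) :
  is_convergence xi -> is_convergence tau ->
  conv_eq xi (I1 xi) -> conv_eq tau (I1 tau) ->
  conv_eq (prod_conv xi tau) (I1 (prod_conv xi tau)).
Proof.
  intros Hxi Htau [hx _] [ht _]; split.
  - intros F p HF [h1 h2].
    destruct (hx _ _ (filter_fmap fst HF) h1) as [H [cH [HHF Hlim]]].
    destruct (ht _ _ (filter_fmap snd HF) h2) as [K [cK [KF Klim]]].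
    destruct (countably_based_decreasing cH) as [B [Bdec HB]].
    destruct (countably_based_decreasing cK) as [C [Cdec KC]].
    destruct cH as [fH _]; destruct cK as [fK _].
    assert (HBn : forall n, H (B n)) by (intro; apply HB; eauto).
    assert (KCn : forall n, K (C n)) by (intro; apply KC; eauto).
    (* One index for both factors is enough because [B] and [C] decrease. *)
    set (L := fun A : X * Y -> Prop =>
      exists n, forall q, B n (fst q) /\ C n (snd q) -> A q).
    assert (fL : is_filter L).
    { repeat split.
      - intros A A' [n Hn] HA; exists n; auto.
      - intros A A' [n Hn] [m Hm]; exists (Nat.max n m); intros q [h k].
        split; [apply Hn | apply Hm]; split;
          first [apply (Bdec _ (Nat.max n m)) | apply (Cdec _ (Nat.max n m))];
          auto; lia.
      - exists 0%nat; auto.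
      - intros [n Hn].
        destruct (filter_nonempty fH (HBn n)) as [a Ha].
        destruct (filter_nonempty fK (KCn n)) as [b Hb].
        apply (Hn (a, b)); auto. }
    exists L; split; [split; [exact fL |] | split].
    + exists (fun n q => B n (fst q) /\ C n (snd q)); reflexivity.
    + intros A [n Hn].
      apply (filter_mono HF (filter_and HF (HHF _ (HBn n)) (KF _ (KCn n)))); auto.
    + split.
      * apply (conv_isotone (F := H) Hxi); auto using filter_fmap.
        intros A HA; destruct (proj1 (HB A) HA) as [n Hn].
        exists n; intros q [h _]; auto.
      * apply (conv_isotone (F := K) Htau); auto using filter_fmap.
        intros A HA; destruct (proj1 (KC A) HA) as [n Hn].
        exists n; intros q [_ h]; auto.
  - intros F p HF [H [[fH _] [HHF Hlim]]].
    apply (conv_isotone (F := H) (prod_conv_convergence Hxi Htau)); auto.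
Qed.

(** * The class defining [Epi_I1] *)

Lemma epi_class_conv_eq X (xi xi' theta : limrel X) :
  conv_eq xi xi' -> epi_class xi theta -> epi_class xi' theta.
Proof.
  intros [e1 e2] [Hth h]; split; auto.
  intros Y tau Ht It.
  apply conv_eq_Tmod_iff; intro O.
  rewrite <- (proj1 (conv_eq_Tmod_iff _ _) (h Y tau Ht It) O).
  split; apply conv_open_ge; apply prod_conv_ge; auto using conv_ge_refl.
Qed.

Lemma conv_open_assoc X Y Z (xi : limrel X) (tau : limrel Y) (sigma : limrel Z)
    (O : X * Y * Z -> Prop) :
  conv_open (prod_conv (prod_conv xi tau) sigma) O <->
  conv_open (prod_conv xi (prod_conv tau sigma))
    (fun p => O (fst p, fst (snd p), snd (snd p))).
Proof.
  split.
  - apply (@conv_open_homeo _ _ (prod_conv xi (prod_conv tau sigma))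
      (prod_conv (prod_conv xi tau) sigma)
      (fun p => (fst p, fst (snd p), snd (snd p))) O).
    intros F x _ [a [b c]]; repeat split; assumption.
  - intros HO F [[x y] z] HF [[a b] c] Ox.
    assert (h := HO (fmap (fun p => (fst (fst p), (snd (fst p), snd p))) F)
      (x, (y, z)) (filter_fmap _ HF) (conj a (conj b c)) Ox).
    apply (filter_mono HF h); intros [[u v] w]; auto.
Qed.

(** Reassociating moves [tau] into the test factor, and [prod_conv tau sigma] again agrees with its
    own [I1]. *)
Lemma epi_class_prod X Y (xi theta : limrel X) (tau : limrel Y) :
  is_convergence tau -> conv_eq tau (I1 tau) ->
  epi_class xi theta -> epi_class (prod_conv xi tau) (prod_conv theta tau).
Proof.
  intros Ht It [Hth h]; split.
  - apply prod_conv_convergence; auto.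
  - intros Z sigma Hs Is.
    apply conv_eq_Tmod_iff; intro O.
    rewrite !conv_open_assoc.
    apply conv_eq_Tmod_iff.
    apply h; auto using prod_conv_convergence, I1_prod.
Qed.

(** The one-point convergence is an admissible test, and openness in a product with it reduces to
    openness in the first factor. *)
Lemma Epi_I1_ge_Tmod X (xi : limrel X) : conv_ge (Epi_I1 xi) (Tmod xi).
Proof.
  intros F x HF [theta [[Hth h] Hx]] O HO Ox.
  set (iota := fun (_ : setfam unit) (_ : unit) => True).
  assert (Hi : is_convergence iota) by (split; unfold iota; auto).
  assert (Ii : conv_eq iota (I1 iota)).
  { split; [| intros G y _ _; exact I].
    intros G y HG _; exists (principal tt); split; [split |].
    - apply filter_principal.
    - exists (fun _ u => u = tt); intro A; split.
      + intro HA; exists 0%nat; intros u ->; exact HA.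
      + intros [_ HA]; apply HA; reflexivity.
    - split; [| exact I].
      intros A HA; apply (filter_all HG); intros []; exact HA. }
  assert (Op : conv_open (prod_conv theta iota) (fun p => O (fst p))).
  { apply (proj1 (conv_eq_Tmod_iff _ _) (h unit iota Hi Ii)).
    apply (@conv_open_homeo _ _ (prod_conv xi iota) xi fst O); auto.
    intros G p _ [a _]; exact a. }
  apply (Op (fmap (fun a => (a, tt)) F) (x, tt)); auto using filter_fmap.
  split; [exact Hx | exact I].
Qed.

(** * Semi-metrics *)

(** For a semi-metric, the coarsest filter converging to [x] for [dconv d]. Without the triangle
    inequality balls need not be open, so its members are only vicinities. *)
Definition nbhd X (d : X -> X -> R) (x : X) : setfam X :=
  fun A => exists eps, 0 < eps /\ forall y, ball d x eps y -> A y.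

Lemma small_inverse (eps : R) : 0 < eps -> exists n, / (INR n + 1) < eps.
Proof.
  intro He; destruct (archimed_cor1 eps He) as [n [h1 h2]].
  exists n; apply Rle_lt_trans with (/ INR n); auto.
  apply Rinv_le_contravar; [apply lt_0_INR; auto | lra].
Qed.

Lemma inverse_pos (n : nat) : 0 < / (INR n + 1).
Proof. apply Rinv_0_lt_compat; generalize (pos_INR n); lra. Qed.

Lemma semimetric_self X (d : X -> X -> R) (x : X) : semimetric d -> d x x = 0.
Proof. intros [_ [_ h]]; apply h; reflexivity. Qed.

Lemma nbhd_countably_based X (d : X -> X -> R) (x : X) :
  semimetric d -> countably_based (nbhd d x).
Proof.
  intro Hd; split.
  - repeat split.
    + intros A B [e [He HA]] HAB; exists e; auto.
    + intros A B [e [He HA]] [e' [He' HB]]; exists (Rmin e e'); split.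
      * apply Rmin_glb_lt; auto.
      * unfold ball in *; intros y Hy; split; [apply HA | apply HB].
        -- apply Rlt_le_trans with (1 := Hy), Rmin_l.
        -- apply Rlt_le_trans with (1 := Hy), Rmin_r.
    + exists 1; split; [lra | auto].
    + intros [e [He HA]]; apply (HA x); unfold ball.
      rewrite semimetric_self; auto.
  - exists (fun n => ball d x (/ (INR n + 1))); intro A; split.
    + intros [e [He HA]]; destruct (small_inverse He) as [n Hn].
      exists n; intros y Hy; apply HA; unfold ball in *; lra.
    + intros [n HA]; exists (/ (INR n + 1)); split; auto using inverse_pos.
Qed.

Lemma nbhd_filter X (d : X -> X -> R) (x : X) :
  semimetric d -> is_filter (nbhd d x).
Proof. intro Hd; apply (nbhd_countably_based x Hd). Qed.

Lemma dconv_nbhd X (d : X -> X -> R) (x : X) : dconv d (nbhd d x) x.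
Proof. intros e He; exists e; auto. Qed.

Lemma dconv_iff_nbhd X (d : X -> X -> R) (F : setfam X) (x : X) :
  is_filter F -> dconv d F x <-> (forall A, nbhd d x A -> F A).
Proof.
  intro HF; split.
  - intros h A [e [He HA]]; apply (filter_mono HF (h e He)); auto.
  - intros h e He; apply h, dconv_nbhd; auto.
Qed.

Lemma dconv_convergence X (d : X -> X -> R) :
  semimetric d -> is_convergence (dconv d).
Proof.
  intro Hd; split.
  - intros F G x _ _ HFG h e He; auto.
  - intros x e He; unfold principal, ball; rewrite semimetric_self; auto.
Qed.

Lemma semi_metrizable_I1 X (tau : limrel X) :
  is_convergence tau -> semi_metrizable tau -> conv_eq tau (I1 tau).
Proof.
  intros Ht [d [Hd [e1 e2]]]; split.
  - intros F x HF Hx; exists (nbhd d x); split; [| split].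
    + apply nbhd_countably_based; auto.
    + apply dconv_iff_nbhd; auto.
    + apply e2, dconv_nbhd; apply nbhd_filter; auto.
  - intros F x HF [H [[fH _] [HHF Hlim]]].
    apply (conv_isotone (F := H) Ht); auto.
Qed.

(** The maximum is chosen so that balls are products of balls of the same radius. *)
Definition max_dist X Y (d : X -> X -> R) (e : Y -> Y -> R) (p q : X * Y) : R :=
  Rmax (d (fst p) (fst q)) (e (snd p) (snd q)).

Lemma max_dist_semimetric X Y (d : X -> X -> R) (e : Y -> Y -> R) :
  semimetric d -> semimetric e -> semimetric (max_dist d e).
Proof.
  intros [d0 [ds d1]] [e0 [es e1]]; unfold max_dist; repeat split.
  - intros p q; apply Rle_trans with (1 := d0 (fst p) (fst q)), Rmax_l.
  - intros p q; rewrite ds, es; reflexivity.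
  - intro h.
    assert (a : d (fst x) (fst y) <= 0) by (rewrite <- h; apply Rmax_l).
    assert (b : e (snd x) (snd y) <= 0) by (rewrite <- h; apply Rmax_r).
    destruct x, y; simpl in *; f_equal; [apply d1 | apply e1]; apply Rle_antisym; auto.
  - intros <-.
    rewrite (proj2 (d1 _ _) eq_refl), (proj2 (e1 _ _) eq_refl).
    apply Rmax_left; lra.
Qed.

Lemma dconv_max_dist X Y (d : X -> X -> R) (e : Y -> Y -> R) :
  conv_eq (dconv (max_dist d e)) (prod_conv (dconv d) (dconv e)).
Proof.
  split.
  - intros F p HF h; split; intros r Hr; apply (filter_mono HF (h r Hr));
      unfold ball, max_dist; intros q Hq;
      apply Rle_lt_trans with (2 := Hq); [apply Rmax_l | apply Rmax_r].
  - intros F p HF [h k] r Hr.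
    apply (filter_mono HF (filter_and HF (h r Hr) (k r Hr))).
    intros q [a b]; apply Rmax_lub_lt; auto.
Qed.

(** The triangle inequality makes balls open. *)
Lemma metric_topology X (d : X -> X -> R) : metric d -> is_topology (dconv d).
Proof.
  intros [Hd tri]; split; [apply dconv_convergence; auto | split].
  - intros F x HF Hx O HO; apply HO; auto.
  - intros F x _ Hx e He; apply Hx.
    + intros G y HG Hy Oy; unfold ball in *.
      apply (filter_mono HG (Hy (e - d x y) ltac:(lra))).
      intros z Hz; generalize (tri x y z); unfold ball in Hz; lra.
    + unfold ball; rewrite semimetric_self; auto.
Qed.

(** * Prime metrizable test spaces *)

(** For nonnegative [r] with at most one zero this is an ultrametric. A point [z] of positive weight
    is alone in its ball of radius [r z], so only the zero can be non-isolated. *)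
Definition weight_dist Z (r : Z -> R) (p q : Z) : R :=
  if excluded_middle_informative (p = q) then 0 else Rmax (r p) (r q).

Lemma weight_dist_metric Z (r : Z -> R) :
  (forall z, 0 <= r z) -> (forall z z', r z = 0 -> r z' = 0 -> z = z') ->
  metric (weight_dist r).
Proof.
  intros r0 r1.
  assert (ml := fun p q => Rmax_l (r p) (r q)).
  assert (mr := fun p q => Rmax_r (r p) (r q)).
  unfold weight_dist; repeat split.
  - intros p q; destruct excluded_middle_informative; [lra |].
    generalize (r0 p) (ml p q); lra.
  - intros p q.
    do 2 destruct excluded_middle_informative; try congruence.
    apply Rmax_comm.
  - destruct excluded_middle_informative; auto.
    intro h; apply r1; generalize (r0 x) (r0 y) (ml x y) (mr x y); lra.
  - intros ->; destruct excluded_middle_informative; congruence.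
  - intros p q s.
    generalize (r0 p) (r0 q) (r0 s) (ml p q) (mr p q) (ml q s) (mr q s); intros.
    repeat destruct excluded_middle_informative; subst; try congruence; try lra.
    apply Rmax_lub; lra.
Qed.

Lemma weight_dist_lt Z (r : Z -> R) (p q : Z) (e : R) :
  weight_dist r p q < e -> p = q \/ (r p < e /\ r q < e).
Proof.
  unfold weight_dist; destruct excluded_middle_informative; auto.
  intro h; right; generalize (Rmax_l (r p) (r q)) (Rmax_r (r p) (r q)); lra.
Qed.

Lemma weight_dist_prime Z (r : Z -> R) :
  (forall z, 0 <= r z) -> (forall z z', r z = 0 -> r z' = 0 -> z = z') ->
  is_prime_topology (dconv (weight_dist r)).
Proof.
  intros r0 r1; split; [apply metric_topology, weight_dist_metric; auto |].
  assert (iso : forall z, ~ isolated (dconv (weight_dist r)) z -> r z = 0).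
  { intros z nz; destruct (Rle_lt_or_eq_dec _ _ (r0 z)) as [pos | ->]; auto.
    exfalso; apply nz; intros F HF Hz A.
    assert (Fz : F (fun q => z = q)).
    { apply (filter_mono HF (Hz _ pos)); intros q Hq.
      destruct (weight_dist_lt Hq); auto; lra. }
    split.
    - intro HA; destruct (filter_nonempty HF (filter_and HF Fz HA)) as [q [-> h]]; auto.
    - intro HA; apply (filter_mono HF Fz); intros q <-; auto. }
  auto.
Qed.

Lemma metric_metrizable X (d : X -> X -> R) : metric d -> metrizable (dconv d).
Proof. intro Hd; exists d; repeat split; try apply Hd; apply conv_ge_refl. Qed.

(** In the space [option (nat * Y)] only [None] is not isolated; the points [(n, z)]
    with [z] outside [B n] get weight [1] so as to stay away from [None]. *)
Definition fan_weight Y (B : nat -> Y -> Prop) (p : option (nat * Y)) : R :=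
  match p with
  | None => 0
  | Some (n, z) =>
      if excluded_middle_informative (B n z) then / (INR n + 1) else 1
  end.

Lemma fan_weight_nonneg Y (B : nat -> Y -> Prop) p : 0 <= fan_weight B p.
Proof.
  destruct p as [[n z] |]; simpl; [| lra].
  destruct excluded_middle_informative; [| lra].
  left; apply inverse_pos.
Qed.

Lemma fan_weight_zero Y (B : nat -> Y -> Prop) p : fan_weight B p = 0 -> p = None.
Proof.
  destruct p as [[n z] |]; simpl; auto.
  generalize (inverse_pos n); destruct excluded_middle_informative; lra.
Qed.

(** The bound is at most [1], which excludes the weight of points outside [B n]. *)
Lemma fan_weight_small Y (B : nat -> Y -> Prop) (k n : nat) (z : Y) :
  fan_weight B (Some (n, z)) < / (INR k + 1) -> B n z /\ (k <= n)%nat.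
Proof.
  assert (pk := pos_INR k); assert (pn := pos_INR n); simpl.
  destruct excluded_middle_informative as [b | b]; intro h.
  - split; auto.
    apply INR_le, Rnot_lt_le; intro nk; apply (Rlt_irrefl (/ (INR k + 1))).
    apply Rle_lt_trans with (2 := h), Rinv_le_contravar; lra.
  - exfalso; apply (Rlt_irrefl 1); apply Rlt_le_trans with (1 := h).
    rewrite <- Rinv_1 at 2; apply Rinv_le_contravar; lra.
Qed.

Definition fan_map Y (y : Y) (p : option (nat * Y)) : Y :=
  match p with None => y | Some (_, z) => z end.

Definition fan_dist Y (B : nat -> Y -> Prop) :=
  weight_dist (fan_weight B).

(* [fan_map y] need not be continuous, since [H] and [principal y] may converge
   without their intersection converging; openness is tested separately on filters
   that avoid [None] and on filters that contain it. *)
Lemma conv_open_fan X Y (alpha : limrel X) (tau : limrel Y) (H : setfam Y)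
    (B : nat -> Y -> Prop) (y : Y) (O : X * Y -> Prop) :
  is_convergence tau -> is_filter H -> tau H y ->
  (forall m n, (m <= n)%nat -> forall z, B n z -> B m z) ->
  (forall A, H A -> exists n, forall z, B n z -> A z) ->
  conv_open (prod_conv alpha tau) O ->
  is_convergence alpha ->
  conv_open (prod_conv alpha (dconv (fan_dist B)))
    (fun p => O (fst p, fan_map y (snd p))).
Proof.
  intros Ht fH Hy Bdec HB HO Ha F [x q] HF [Fx Fq] Oxq; simpl in *.
  (* Openness of [O] applies to the image of [G] once its projection to [Y] refines a filter [K]
     converging to the right point. [K] will be a principal filter in one case and [H] in the
     other. *)
  assert (push : forall (G : setfam (X * option (nat * Y))) (K : setfam Y),
    is_filter G -> (forall A, F A -> G A) ->
    is_filter K -> tau K (fan_map y q) ->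
    (forall A, K A -> G (fun p => A (fan_map y (snd p)))) ->
    G (fun p => O (fst p, fan_map y (snd p)))).
  { intros G K fG FG fK Klim KG.
    apply (HO (fmap (fun p => (fst p, fan_map y (snd p))) G) (x, fan_map y q));
      auto using filter_fmap.
    split.
    - apply (conv_isotone (F := fmap fst F) Ha); auto using filter_fmap.
      intros A; apply FG.
    - apply (conv_isotone (F := K) Ht); auto using filter_fmap. }
  apply filter_split with (S := fun p => snd p = q); auto.
  intros G fG FG [Gq | Gq].
  - apply (push G (principal (fan_map y q))); auto using filter_principal.
    + apply Ht.
    + intros A HA; apply (filter_mono fG Gq); intros p ->; exact HA.
  (* Two distinct points at distance below [e] both have weight below [e]; hence [q] has weight zero
     and must be [None]. *)
  - assert (near : forall e, 0 < e ->
      G (fun p => fan_weight B q < e /\ fan_weight B (snd p) < e /\ snd p <> q)).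
    { intros e He.
      apply (filter_mono fG (filter_and fG Gq (FG _ (Fq e He)))).
      intros p [np Hp]; destruct (weight_dist_lt Hp); intuition congruence. }
    assert (q0 : q = None).
    { apply (fan_weight_zero (B := B)); apply Rle_antisym; [| apply fan_weight_nonneg].
      apply Rnot_lt_le; intro pos.
      destruct (filter_nonempty fG (near _ pos)) as [p [Hp _]]; lra. }
    subst q.
    apply (push G H); auto.
    intros A HA; destruct (HB A HA) as [k Hk].
    (* Small weight puts [z] in [B n] with [n] at least [k], hence in [B k]. *)
    apply (filter_mono fG (near _ (inverse_pos k))).
    intros [a [[n z] |]] [_ [Hp np]]; simpl in *; [| congruence].
    apply Hk; destruct (fan_weight_small Hp); eauto.
Qed.

(** A convergent filter on [X * Y] is lifted to one on the product of [X] with the fan, converging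
    to [(x, None)]. The pullback of [O] is open there by [conv_open_fan], so the test hypothesis
    puts it in the lifted filter, and projecting back puts [O] in the original one. *)
Lemma prime_metrizable_test X (alpha xi : limrel X) :
  is_convergence alpha -> is_convergence xi -> conv_ge alpha xi ->
  (forall (Z : Type) (sigma : limrel Z), is_prime_topology sigma -> metrizable sigma ->
     conv_ge (prod_conv xi sigma) (Tmod (prod_conv alpha sigma))) ->
  epi_class alpha xi.
Proof.
  intros Ha Hxi ge test; split; auto.
  intros Y tau Ht [It _]; apply conv_eq_Tmod_iff; intro O; split.
  2: apply conv_open_ge, prod_conv_ge; auto using conv_ge_refl.
  intros HO F [x y] HF [Fx Fy] Oxy; simpl in *.
  destruct (It _ _ (filter_fmap snd HF) Fy) as [H [cH [HHF Hlim]]].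
  destruct (countably_based_decreasing cH) as [B [Bdec HB]].
  destruct cH as [fH _].
  assert (FB : forall n, F (fun p => B n (snd p))).
  { intro n; apply HHF, HB; eauto. }
  assert (w0 := fan_weight_nonneg B).
  assert (w1 : forall p q, fan_weight B p = 0 -> fan_weight B q = 0 -> p = q).
  { intros p q h k; rewrite (fan_weight_zero h), (fan_weight_zero k); auto. }
  (* Each pair [(a, z)] is copied to every level [n] with [B n z]; basic sets keep the levels from
     [k] on. Properness uses that [F] contains every [B k] in the second coordinate. *)
  set (lift := fun A : X * option (nat * Y) -> Prop =>
    exists (A' : X * Y -> Prop) (k : nat), F A' /\
      forall a n z, A' (a, z) -> B n z -> (k <= n)%nat -> A (a, Some (n, z))).
  assert (flift : is_filter lift).
  { repeat split.
    - intros A C [A' [k [FA HA]]] AC; exists A', k; auto.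
    - intros A C [A' [k [FA HA]]] [C' [l [FC HC]]].
      exists (fun p => A' p /\ C' p), (Nat.max k l); split.
      + apply filter_and; auto.
      + intros a n z [h1 h2] Hb Hn; split; [apply HA | apply HC]; auto; lia.
    - exists (fun _ => True), 0%nat; split; [apply HF | auto].
    - intros [A' [k [FA HA]]].
      destruct (filter_nonempty HF (filter_and HF FA (FB k))) as [[a z] [h1 h2]].
      apply (HA a k z); auto. }
  assert (key : lift (fun p => O (fst p, fan_map y (snd p)))).
  { apply (test _ _ (weight_dist_prime w0 w1)
        (metric_metrizable (weight_dist_metric w0 w1)) lift (x, None)); auto.
    - split; simpl.
      + apply (conv_isotone (F := fmap fst F) Hxi); auto using filter_fmap.
        intros A HA; exists (fun p => A (fst p)), 0%nat; auto.
      + intros e He; destruct (small_inverse He) as [k Hk].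
        exists (fun p => B k (snd p)), k; split; auto.
        intros a n z _ Hb Hn; unfold ball, weight_dist; simpl.
        destruct excluded_middle_informative; [congruence |].
        destruct excluded_middle_informative; [| tauto].
        apply Rmax_lub_lt; auto.
        apply Rle_lt_trans with (2 := Hk), Rinv_le_contravar.
        * generalize (pos_INR k); lra.
        * apply le_INR in Hn; lra.
    - apply conv_open_fan with (tau := tau) (H := H); auto.
      intros A; apply HB. }
  (* Level [k] alone suffices to return to [F], since [F] contains [B k] in the second
     coordinate. *)
  destruct key as [A' [k [FA HA]]].
  apply (filter_mono HF (filter_and HF FA (FB k))).
  intros [a z] [h1 h2]; apply (HA a k z); auto.
Qed.

(** * Symmetrizability *)

(** If [H] omits a ball around [x], a sequence [s] picked outside that ball along the base still
    converges to [x] for [xi]. The complement of its range turns out to be open and contains [x], so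
    the tails of [s] would have to avoid the range of [s]. *)
Lemma hausdorff_symmetrizable_countably_based X (xi : limrel X) (d : X -> X -> R)
    (H : setfam X) (x : X) :
  is_convergence xi -> hausdorff xi -> semimetric d ->
  conv_ge (dconv d) xi -> conv_ge xi (Tmod (dconv d)) ->
  countably_based H -> xi H x -> dconv d H x.
Proof.
  intros Hxi Haus [d0 [ds d1]] dxi xiT cH Hx e He.
  destruct (countably_based_decreasing cH) as [B [Bdec HB]].
  destruct cH as [fH _].
  apply NNPP; intro nH.
  assert (pick : forall n, exists z, B n z /\ e <= d x z).
  { intro n; apply NNPP; intro c; apply nH, HB; exists n; intros z Hz.
    apply Rnot_le_lt; intro; apply c; eauto. }
  destruct (functional_choice _ pick) as [s Hs].
  set (E := fun A : X -> Prop => exists k, forall n, (k <= n)%nat -> A (s n)).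
  assert (fE : is_filter E).
  { repeat split.
    - intros A C [k HA] AC; exists k; auto.
    - intros A C [k HA] [l HC]; exists (Nat.max k l); intros n Hn.
      split; [apply HA | apply HC]; lia.
    - exists 0%nat; auto.
    - intros [k HA]; apply (HA k); auto. }
  assert (Ex : xi E x).
  { apply (conv_isotone (F := H) Hxi); auto.
    intros A HA; destruct (proj1 (HB A) HA) as [k Hk].
    exists k; intros n Hn; apply Hk, (Bdec k n Hn), Hs. }
  assert (op : conv_open (dconv d) (fun z => forall n, z <> s n)).
  { intros G y fG Gy Oy; apply NNPP; intro nG.
    (* Every ball around [y] meets the sequence arbitrarily late: shrinking the radius to at most
       [d y (s k)], positive because [y] is not on the sequence, skips the term [s k]. *)
    assert (far : forall k r, 0 < r -> exists n, (k <= n)%nat /\ d y (s n) < r).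
    { induction k as [| k IH]; intros r Hr; apply NNPP; intro c.
      - apply nG, (filter_mono fG (Gy r Hr)); intros z Hz n ->.
        apply c; exists n; split; [lia | exact Hz].
      - assert (pos : 0 < d y (s k)).
        { destruct (Rle_lt_or_eq_dec _ _ (d0 y (s k))) as [h | h]; auto.
          exfalso; apply (Oy k), d1; auto. }
        destruct (IH (Rmin r (d y (s k)))) as [n [Hn Hd]].
        { apply Rmin_glb_lt; auto. }
        apply c; exists n; split.
        + destruct (Nat.eq_dec k n) as [-> | ne]; [| lia].
          generalize (Rmin_r r (d y (s n))); lra.
        + apply Rlt_le_trans with (1 := Hd), Rmin_l. }
    (* The common refinement of the tails of [s] and the balls around [y] converges to both [x] and
       [y], so the Hausdorff property identifies them; but [s] stays at distance at least [e] from
       [x]. *)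
    set (M := fun A : X -> Prop => exists k r, 0 < r /\
      forall n, (k <= n)%nat -> d y (s n) < r -> A (s n)).
    assert (fM : is_filter M).
    { repeat split.
      - intros A C [k [r [Hr HA]]] AC; exists k, r; auto.
      - intros A C [k [r [Hr HA]]] [l [t [Ht HC]]].
        exists (Nat.max k l), (Rmin r t); split; [apply Rmin_glb_lt; auto |].
        intros n Hn Hd; generalize (Rmin_l r t) (Rmin_r r t); intros.
        split; [apply HA | apply HC]; first [lia | lra].
      - exists 0%nat, 1; split; [lra | auto].
      - intros [k [r [Hr HA]]]; destruct (far k r Hr) as [n [Hn Hd]].
        apply (HA n); auto. }
    assert (xy : x = y).
    { apply (Haus M); auto.
      - apply (conv_isotone (F := E) Hxi); auto.
        intros A [k HA]; exists k, 1; split; [lra | auto].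
      - apply dxi; auto.
        intros r Hr; exists 0%nat, r; auto. }
    subst y; destruct (far 0%nat e He) as [n [_ Hn]].
    generalize (proj2 (Hs n)); lra. }
  assert (off : forall n, x <> s n).
  { intros n h; generalize (proj2 (Hs n)); rewrite <- h.
    rewrite (proj2 (d1 x x) eq_refl); lra. }
  destruct (xiT E x fE Ex _ op off) as [k Hk].
  apply (Hk k (Nat.le_refl k) k); reflexivity.
Qed.

Lemma strongly_symmetrizable_symmetrizable X (xi : limrel X) :
  strongly_symmetrizable xi -> symmetrizable xi.
Proof.
  intros [d [Hd [h k]]]; exists d; repeat split; try apply Hd; auto.
  intros F x HF Hx; apply Epi_I1_ge_Tmod; auto.
Qed.

(** A limit for [Epi_I1 (dconv d)] comes from a single [theta] in the class, and
    [prod_conv theta tau] then lies in the class of the product, which is that of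
    [dconv (max_dist d e)]. *)
Lemma strongly_symmetrizable_prod X Y (xi : limrel X) (tau : limrel Y) :
  is_convergence tau -> semi_metrizable tau ->
  strongly_symmetrizable xi -> strongly_symmetrizable (prod_conv xi tau).
Proof.
  intros Ht smt [d [Hd [dxi xiE]]].
  assert (It := semi_metrizable_I1 Ht smt).
  destruct smt as [e [He [te et]]].
  destruct (dconv_max_dist d e) as [m1 m2].
  assert (eqD : conv_eq (prod_conv (dconv d) tau) (dconv (max_dist d e))).
  { split; intros F p HF h.
    - apply m2; auto; revert F p HF h; apply prod_conv_ge; auto using conv_ge_refl.
    - apply m1 in h; auto; revert F p HF h; apply prod_conv_ge; auto using conv_ge_refl. }
  exists (max_dist d e); split; [apply max_dist_semimetric; auto | split].
  - intros F p HF h; apply eqD in h; auto.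
    revert F p HF h; apply prod_conv_ge; auto using conv_ge_refl.
  - intros F p HF [h k].
    destruct (xiE _ _ (filter_fmap fst HF) h) as [theta [cth Hth]].
    exists (prod_conv theta tau); split; [| split; auto].
    apply (epi_class_conv_eq eqD), epi_class_prod; auto.
Qed.

(** The vicinity filter at [x] refines [nbhd d x], which converges to [x]. *)
Lemma metrizable_pretopology X (tau : limrel X) :
  is_convergence tau -> metrizable tau -> is_pretopology tau.
Proof.
  intros Ht [d [[Hd _] [td dt]]]; split; auto; intro x.
  apply (conv_isotone (F := nbhd d x) Ht).
  - apply nbhd_filter; auto.
  - repeat split.
    + intros A B h AB F HF Fx; apply (filter_mono HF (h F HF Fx)); auto.
    + intros A B h k F HF Fx; exact (filter_and HF (h F HF Fx) (k F HF Fx)).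
    + intros F HF _; apply HF.
    + intro h; apply (h (principal x)); [apply filter_principal | apply Ht].
  - intros A HA F HF Fx; apply dconv_iff_nbhd with (d := d) (x := x); auto.
  - apply dt; [apply nbhd_filter; auto | apply dconv_nbhd].
Qed.

(** Every filter on a one-point space converges, so restricting [D] to the slice at [tt] gives the
    semi-metric. *)
Lemma symmetrizable_of_prod_unit X (xi : limrel X) (tau : limrel unit) :
  is_convergence tau -> symmetrizable (prod_conv xi tau) -> symmetrizable xi.
Proof.
  intros Ht [D [[D0 [Ds D1]] [Dxi xiD]]].
  assert (unit_lim : forall G, is_filter G -> tau G tt).
  { intros G HG; apply (conv_isotone (F := principal tt) Ht);
      auto using filter_principal.
    - intros A HA; apply (filter_all HG); intros []; exact HA.
    - apply Ht. }
  exists (fun a b => D (a, tt) (b, tt)); split; [| split].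
  - repeat split; auto.
    + intro h; apply D1 in h; congruence.
    + intros ->; apply D1; reflexivity.
  - intros F x HF Fx.
    apply (Dxi (fmap (fun a => (a, tt)) F) (x, tt)); auto using filter_fmap.
  - intros F x HF Fx O HO Ox.
    apply (xiD (fmap (fun a => (a, tt)) F) (x, tt) (filter_fmap _ HF))
      with (O := fun p => O (fst p)); auto.
    + split; [exact Fx | apply unit_lim; do 2 apply filter_fmap; exact HF].
    + apply (@conv_open_homeo _ _ (dconv D)
        (dconv (fun a b => D (a, tt) (b, tt))) fst O); auto.
      intros G [a []] HG Ga e He.
      apply (filter_mono HG (Ga e He)); intros [b []]; auto.
Qed.

Lemma symmetrizable_prod_ge X Y (xi : limrel X) (tau : limrel Y) (d : X -> X -> R) :
  is_convergence xi -> hausdorff xi -> is_convergence tau -> semimetric d ->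
  conv_ge (dconv d) xi -> conv_ge xi (Tmod (dconv d)) ->
  symmetrizable (prod_conv xi tau) ->
  conv_ge (prod_conv xi tau) (Tmod (prod_conv (dconv d) tau)).
Proof.
  intros Hxi Haus Ht Hd dxi xid [D [HD [Dx xD]]].
  assert (h : conv_ge (dconv D) (prod_conv (dconv d) tau)).
  { intros F p HF Fp.
    assert (fN := nbhd_filter p HD).
    apply (conv_isotone (F := nbhd D p) (prod_conv_convergence (dconv_convergence Hd) Ht)); auto.
    - apply dconv_iff_nbhd; auto.
    (* Only the first projection must be strengthened from [xi] to [dconv d]; it is countably based
       as an image of [nbhd D p]. *)
    - destruct (Dx _ _ fN (dconv_nbhd D p)) as [a b]; split; auto.
      apply (hausdorff_symmetrizable_countably_based Hxi Haus Hd dxi xid); auto.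
      apply countably_based_fmap, nbhd_countably_based; auto. }
  intros F p HF Fp; apply (conv_ge_Tmod h); auto.
Qed.

Lemma symmetrizable_prod_strongly X (xi : limrel X) :
  is_convergence xi -> hausdorff xi ->
  (forall (Y : Type) (tau : limrel Y), is_prime_topology tau -> metrizable tau ->
     symmetrizable (prod_conv xi tau)) ->
  strongly_symmetrizable xi.
Proof.
  intros Hxi Haus H.
  assert (w0 : forall u : unit, 0 <= 0) by (intro; lra).
  assert (w1 : forall u v : unit, 0 = 0 -> 0 = 0 -> u = v) by (intros [] []; auto).
  (* The one-point space, presented as a weight metric so that it is visibly prime and
     metrizable. *)
  assert (pt := weight_dist_prime (r := fun _ : unit => 0) w0 w1).
  destruct (@symmetrizable_of_prod_unit X xi _ (proj1 (proj1 pt))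
    (H _ _ pt (metric_metrizable (weight_dist_metric (r := fun _ => 0) w0 w1))))
    as [d [Hd [dxi xid]]].
  exists d; split; [exact Hd | split; [exact dxi |]].
  (* [xi] itself is the member of the class of [dconv d] that witnesses the limit. *)
  intros F x _ Fx; exists xi; split; [| exact Fx].
  apply prime_metrizable_test; auto using dconv_convergence.
  intros Z sigma Ps Ms.
  apply symmetrizable_prod_ge; auto; apply Ps.
Qed.

Theorem theorem5p7 (X : Type) (xi : limrel X) :
  is_convergence xi -> hausdorff xi ->
  ((strongly_symmetrizable xi <->
    (forall (Y : Type) (tau : limrel Y),
       is_pretopology tau -> semi_metrizable tau ->
       strongly_symmetrizable (prod_conv xi tau))) /\
   (strongly_symmetrizable xi <->
    (forall (Y : Type) (tau : limrel Y),
       is_prime_topology tau -> metrizable tau ->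
       symmetrizable (prod_conv xi tau)))).
Proof.
  intros Hxi Haus.
  assert (h12 : strongly_symmetrizable xi ->
    forall (Y : Type) (tau : limrel Y), is_pretopology tau -> semi_metrizable tau ->
    strongly_symmetrizable (prod_conv xi tau)).
  { intros h Y tau Pt St; apply strongly_symmetrizable_prod; auto; apply Pt. }
  assert (h23 : (forall (Y : Type) (tau : limrel Y),
      is_pretopology tau -> semi_metrizable tau ->
      strongly_symmetrizable (prod_conv xi tau)) ->
    forall (Y : Type) (tau : limrel Y), is_prime_topology tau -> metrizable tau ->
    symmetrizable (prod_conv xi tau)).
  { intros h Y tau Pt Mt; apply strongly_symmetrizable_symmetrizable, h.
    - apply metrizable_pretopology; auto; apply Pt.
    - destruct Mt as [d [[Hd _] e]]; exists d; auto. }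
  assert (h31 := symmetrizable_prod_strongly Hxi Haus).
  split; split; auto.
Qed.
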